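(* Let $(\mathfrak{g},[\cdot,\cdot]_\mathfrak{g})$ be a Lie algebra and let $N:\mathfrak{g}\to\mathfrak{g}$ be a Nijenhuis operator on it. For $n\ge 0$ define $\Phi_n:\mathrm{Hom}(\wedge^n\mathfrak{g},\mathfrak{g})\to\mathrm{Hom}(\wedge^{n+1}\mathfrak{g},\mathfrak{g})$ by $\Phi_n(f)=(-1)^{n+1}\delta_{\mathrm{CE}}(f)$, where $\delta_{\mathrm{CE}}$ is the Chevalley-Eilenberg coboundary of $(\mathfrak{g},[\cdot,\cdot]_\mathfrak{g})$ with coefficients in the adjoint representation. Then $$\delta^N_{\mathrm{CE}}\circ\Phi_n=\Phi_{n+1}\circ d_N\qquad\text{for all } n\ge 0,$$ where $\delta^N_{\mathrm{CE}}$ is the Chevalley-Eilenberg coboundary of the deformed Lie algebra $\mathfrak{g}^N=(\mathfrak{g},[\cdot,\cdot]^N_\mathfrak{g})$ with coefficients in its adjoint representation. As a consequence, there is a homomorphism $H^\bullet(N)\to H^{\bullet+1}_{\mathrm{CE}}(\mathfrak{g}^N)$ from the cohomology of the Nijenhuis operator $N$ to the Chevalley-Eilenberg cohomology of the deformed Lie algebra (with adjoint coefficients).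
   Context: All vector spaces are over a fixed field $\mathbf{k}$. A Nijenhuis operator on a Lie algebra $(\mathfrak{g},[\cdot,\cdot]_\mathfrak{g})$ is a linear map $N:\mathfrak{g}\to\mathfrak{g}$ with $[N(x),N(y)]_\mathfrak{g}=N\big([N(x),y]_\mathfrak{g}+[x,N(y)]_\mathfrak{g}-N[x,y]_\mathfrak{g}\big)$ for all $x,y\in\mathfrak{g}$. The deformed Lie algebra $\mathfrak{g}^N$ is the vector space $\mathfrak{g}$ with the Lie bracket $[x,y]^N_\mathfrak{g}=[N(x),y]_\mathfrak{g}+[x,N(y)]_\mathfrak{g}-N[x,y]_\mathfrak{g}$. The Chevalley-Eilenberg coboundary with adjoint coefficients is $$(\delta_{\mathrm{CE}}f)(x_1,\dots,x_{n+1})=\sum_{i=1}^{n+1}(-1)^{i+1}[x_i,f(x_1,\dots,\widehat{x_i},\dots,x_{n+1})]_\mathfrak{g}+\sum_{1\le i<j\le n+1}(-1)^{i+j}f([x_i,x_j]_\mathfrak{g},x_1,\dots,\widehat{x_i},\dots,\widehat{x_j},\dots,x_{n+1}),$$ and $\delta^N_{\mathrm{CE}}$ is given by the same formula with $[\cdot,\cdot]_\mathfrak{g}$ replaced everywhere by $[\cdot,\cdot]^N_\mathfrak{g}$. The cochain complex of the Nijenhuis operator $N$ is $\{\oplus_{n\ge0}\mathrm{Hom}(\wedge^n\mathfrak{g},\mathfrak{g}),d_N\}$, where for $x\in\mathfrak{g}=\mathrm{Hom}(\wedge^0\mathfrak{g},\mathfrak{g})$, $d_N(x)(y)=[N(y),x]_\mathfrak{g}-N[y,x]_\mathfrak{g}$,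 and for $n\ge1$, $f\in\mathrm{Hom}(\wedge^n\mathfrak{g},\mathfrak{g})$, $$(d_Nf)(x_1,\dots,x_{n+1})=\sum_{i}(-1)^{i+1}[N(x_i),f(x_1,\dots,\widehat{x_i},\dots,x_{n+1})]_\mathfrak{g}+\sum_{i<j}(-1)^{i+j}f([x_i,x_j]^N_\mathfrak{g},x_1,\dots,\widehat{x_i},\dots,\widehat{x_j},\dots,x_{n+1})-N\big((\delta_{\mathrm{CE}}f)(x_1,\dots,x_{n+1})\big).$$ One has $(d_N)^2=0$, and $H^\bullet(N)$ denotes the cohomology of this complex. *)

(* Defs.v *)
From HB Require Import structures.
From mathcomp Require Import all_boot all_order all_algebra.
From mathcomp Require Import zify.
From mathcomp Require Import boolp functions.

Set Implicit Arguments.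
Unset Strict Implicit.
Unset Printing Implicit Defensive.

Import GRing.Theory.
Local Open Scope ring_scope.
Local Open Scope quotient_scope.

Record lie_algebra (k : fieldType) (g : lmodType k) := LieAlgebra {
  lie_bracket :> {bilinear g -> g -> g};
  lie_alt : forall x, lie_bracket x x = 0;
  lie_jacobi : forall x y z,
    lie_bracket x (lie_bracket y z) + lie_bracket y (lie_bracket z x)
      + lie_bracket z (lie_bracket x y) = 0
}.

Notation "[ x , y ]_ L" := (lie_bracket L x y)
  (at level 0, x, y at level 99, L at level 2, format "[ x ,  y ]_ L")
  : ring_scope.

Section Arguments.
Variables (k : fieldType) (g : lmodType k).

Definition upd n (x : {ffun 'I_n -> g}) (p : 'I_n) (u : g) : {ffun 'I_n -> g} :=
  [ffun l => if l == p then u else x l].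

Definition multilinear n (f : {ffun 'I_n -> g} -> g) : Prop :=
  forall p x a u v,
    f (upd x p (a *: u + v)) = a *: f (upd x p u) + f (upd x p v).

Definition alternating n (f : {ffun 'I_n -> g} -> g) : Prop :=
  forall (x : {ffun 'I_n -> g}) (p q : 'I_n), p != q -> x p = x q -> f x = 0.

Definition omit n (i : 'I_n.+1) (x : {ffun 'I_n.+1 -> g}) : {ffun 'I_n -> g} :=
  [ffun l => x (lift i l)].

(* For i < j this is (u, x_0, .., ^x_i, .., ^x_j, .., x_n): the map
   l |-> bump j (bump i l) enumerates the naturals other than i and j in
   increasing order. *)
Definition omit2 n (i j : 'I_n.+1) (u : g) (x : {ffun 'I_n.+1 -> g}) :
    {ffun 'I_n -> g} :=
  [ffun l : 'I_n =>
     if l == 0 :> nat then u else x (inord (bump j (bump i l.-1)))].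

(* The Chevalley-Eilenberg formula for a bracket beta and an action rho.
   Indices start at 0 here, so the sign (-1)^(i+1) of the usual formula becomes
   (-1)^i, while (-1)^(i+j) is unchanged. *)
Definition ce_formula (rho beta : g -> g -> g) n (f : {ffun 'I_n -> g} -> g)
    (x : {ffun 'I_n.+1 -> g}) : g :=
  \sum_(i < n.+1) (-1) ^+ i *: rho (x i) (f (omit i x))
  + \sum_(i < n.+1) \sum_(j < n.+1 | (i < j)%N)
      (-1) ^+ (i + j) *: f (omit2 i j (beta (x i) (x j)) x).

Lemma alternating_adjacent n (f : {ffun 'I_n -> g} -> g) :
  multilinear f ->
  (forall (x : {ffun 'I_n -> g}) (p q : 'I_n), q = p.+1 :> nat -> x p = x q -> f x = 0) ->
  alternating f.
Proof.
move=> fM fA.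
have fD p x u v : f (upd x p (u + v)) = f (upd x p u) + f (upd x p v).
  by have := fM p x 1 u v; rewrite !scale1r.
suff H d : forall (x : {ffun 'I_n -> g}) (p q : 'I_n), q = (p + d).+1 :> nat -> x p = x q -> f x = 0.
  move=> x p q npq xpq.
  have [lt_pq|lt_qp|/ord_inj pq] := ltngtP p q.
  - by apply: (H (q - p.+1)%N x p q) => //; lia.
  - by apply: (H (p - q.+1)%N x q p) => //; lia.
  - by rewrite pq eqxx in npq.
elim: d => [|d IHd] x p q qE xpq; first by apply: (fA x p q) => //; lia.
have rn : (p.+1 < n)%N by have := ltn_ord q; lia.
pose r := Ordinal rn.
have npr : p != r by apply/eqP => /(congr1 val) /=; lia.
have nqr : q != r by apply/eqP => /(congr1 val) /=; lia.
have nqp : q != p by apply/eqP => /(congr1 val) /=; lia.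
pose y a b := upd (upd x p a) r b.
have yC a b : y a b = upd (upd x r b) p a.
  apply/ffunP => l; rewrite !ffunE.
  by have [->|//] := eqVneq l r; rewrite eq_sym (negPf npr).
have y0 a : f (y a a) = 0.
  by apply: (fA _ p r) => //; rewrite !ffunE !eqxx (negPf npr).
have := y0 (x p + x r).
rewrite {1}/y fD -!/(y _ _) !yC !fD -!yC !y0 add0r addr0 => fyy.
have yrp : f (y (x r) (x p)) = 0.
  apply: (IHd _ r q); first by rewrite qE /=; lia.
  by rewrite !ffunE eqxx (negPf nqr) (negPf nqp).
have -> : x = y (x p) (x r).
  apply/ffunP => l; rewrite !ffunE.
  by have [->//|_] := eqVneq l r; have [->|] := eqVneq l p.
by move: fyy; rewrite yrp ?addr0 ?add0r.
Qed.

Lemma omit_upd n (x : {ffun 'I_n.+1 -> g}) p u : omit p (upd x p u) = omit p x.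
Proof. by apply/ffunP => l; rewrite !ffunE eq_sym (negPf (neq_lift _ _)). Qed.

Lemma omit_upd_neq n (x : {ffun 'I_n.+1 -> g}) (i p : 'I_n.+1) :
  i != p -> exists q, forall u, omit i (upd x p u) = upd (omit i x) q u.
Proof.
move=> /unlift_some[q pE _]; exists q => u.
by apply/ffunP => l; rewrite !ffunE pE (inj_eq lift_inj).
Qed.

Lemma omit2_indexE n (i j : 'I_n.+1) (l : 'I_n) : (0 < l)%N ->
  (inord (bump j (bump i l.-1)) : 'I_n.+1) = bump j (bump i l.-1) :> nat.
Proof.
by move=> l0; rewrite inordK //; have := ltn_ord l; rewrite /bump; lia.
Qed.

Lemma omit2_upd n (x : {ffun 'I_n.+1 -> g}) (i j p : 'I_n.+1) w u :
  (i < j)%N -> (p == i) || (p == j) ->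
  omit2 i j w (upd x p u) = omit2 i j w x.
Proof.
move=> ij pij; apply/ffunP => l; rewrite !ffunE; case: posnP => // l0.
rewrite ifN //; apply/eqP => /(congr1 val) /=; rewrite omit2_indexE //.
by case/orP: pij => /eqP->; rewrite /bump; lia.
Qed.

Lemma omit2_position n (i j p : 'I_n.+1) :
  (i < j)%N -> p != i -> p != j ->
  exists2 q : 'I_n, (0 < q)%N & forall l : 'I_n, (0 < l)%N ->
    (inord (bump j (bump i l.-1)) == p) = (l == q).
Proof.
move=> ij npi npj.
have npi' : nat_of_ord p <> i by move=> /ord_inj/eqP; rewrite (negPf npi).
have npj' : nat_of_ord p <> j by move=> /ord_inj/eqP; rewrite (negPf npj).
have qn : ((unbump i (unbump j p)).+1 < n)%N.
  by have := ltn_ord p; have := ltn_ord j; rewrite /unbump; lia.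
exists (Ordinal qn) => // l l0.
apply/eqP/eqP => [/(congr1 val)/=|/(congr1 val)/= lE].
  rewrite omit2_indexE // => pE; apply: val_inj.
  by move: pE; rewrite /= /bump /unbump; lia.
apply: val_inj; rewrite /= omit2_indexE //.
by move: lE; rewrite /bump /unbump; lia.
Qed.

Lemma omit2_upd_neq n (x : {ffun 'I_n.+1 -> g}) (i j p : 'I_n.+1) :
  (i < j)%N -> p != i -> p != j ->
  exists q, forall w u, omit2 i j w (upd x p u) = upd (omit2 i j w x) q u.
Proof.
move=> ij npi npj; have [q q0 qP] := omit2_position ij npi npj.
exists q => w u; apply/ffunP => l; rewrite !ffunE.
have [l0|l0] := posnP l; last by rewrite qP.
by rewrite ifN //; apply/eqP => lq; rewrite lq in l0; lia.
Qed.

Lemma multilinear_omit2 n (f : {ffun 'I_n -> g} -> g) (i j : 'I_n.+1) x a u v :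
  (i < j)%N -> multilinear f ->
  f (omit2 i j (a *: u + v) x) = a *: f (omit2 i j u x) + f (omit2 i j v x).
Proof.
move=> ij fM; have n0 : (0 < n)%N by have := ltn_ord j; lia.
suff E w : omit2 i j w x = upd (omit2 i j 0 x) (Ordinal n0) w by rewrite (E (_ + _)) (E u) (E v) fM.
apply/ffunP => l; rewrite !ffunE -val_eqE /=; by case: eqP.
Qed.

Lemma sum_adjacent_eq0 n (F : 'I_n -> g) (p q : 'I_n) : p != q ->
  (forall i, i != p -> i != q -> F i = 0) -> F p + F q = 0 -> \sum_i F i = 0.
Proof.
move=> npq F0 Fpq; rewrite (bigD1 p) //= (bigD1 q) 1?eq_sym //= addrA Fpq add0r.
by apply: big1 => i /andP[]; apply: F0.
Qed.

Lemma scale_linearP (s a : k) (u v : g) :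
  s *: (a *: u + v) = a *: (s *: u) + s *: v.
Proof. by rewrite scalerDr !scalerA mulrC. Qed.

Lemma ce_multilinear (rho beta : {bilinear g -> g -> g}) n
    (f : {ffun 'I_n -> g} -> g) :
  multilinear f -> multilinear (ce_formula rho beta f).
Proof.
move=> fM p x a u v; rewrite /ce_formula scalerDr addrACA; congr (_ + _).
  rewrite scaler_sumr -big_split; apply: eq_bigr => i _ /=.
  rewrite -scale_linearP; congr (_ *: _).
  have [->|nip] := eqVneq i p.
    by rewrite !omit_upd !ffunE eqxx linearDl linearZl_LR.
  have [q qE] := omit_upd_neq x nip.
  by rewrite !qE !ffunE (negPf nip) fM linearDr linearZr_LR.
rewrite scaler_sumr -big_split; apply: eq_bigr => i _ /=.
rewrite scaler_sumr -big_split; apply: eq_bigr => j ij /=.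
rewrite -scale_linearP; congr (_ *: _).
have nij : i != j by apply/eqP => E; rewrite E ltnn in ij.
have [pi|npi] := eqVneq p i.
  rewrite pi !omit2_upd ?eqxx // !ffunE eqxx eq_sym (negPf nij).
  by rewrite linearDl linearZl_LR multilinear_omit2.
have [pj|npj] := eqVneq p j.
  rewrite pj !omit2_upd ?eqxx ?orbT // !ffunE eqxx (negPf nij).
  by rewrite linearDr linearZr_LR multilinear_omit2.
have [q qE] := omit2_upd_neq x ij npi npj.
by rewrite !qE !ffunE ![_ == p]eq_sym (negPf npi) (negPf npj) fM.
Qed.

Lemma ce_alternating (rho beta : {bilinear g -> g -> g}) n
    (f : {ffun 'I_n -> g} -> g) :
  (forall x, beta x x = 0) -> multilinear f -> alternating f ->
  alternating (ce_formula rho beta f).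
Proof.
move=> beta0 fM fA; apply: alternating_adjacent; first exact: ce_multilinear.
move=> x p q qE xpq.
have npq : p != q by apply/eqP => /(congr1 val) /=; lia.
rewrite /ce_formula; set S1 := (X in X + _); set S2 := (X in _ + X).
have -> : S1 = 0.
  apply: (sum_adjacent_eq0 npq) => [i nip niq|].
    have [p' pE _] := unlift_some nip; have [q' q'E _] := unlift_some niq.
    rewrite (fA _ p' q') ?linear0r ?scaler0 //.
      by apply: contraNneq npq => pq; rewrite pE q'E pq.
    by rewrite !ffunE -pE -q'E.
  have -> : omit q x = omit p x.
    apply/ffunP => l; rewrite !ffunE.
    have [lE|nl] := eqVneq (nat_of_ord l) (nat_of_ord p).
      rewrite (_ : lift q l = p) 1?(_ : lift p l = q) //;
        by apply: val_inj; rewrite /= /bump; move: lE => /=; lia.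
    by congr (x _); apply: val_inj; move: nl; rewrite /= /bump; lia.
  by rewrite xpq qE exprS mulN1r scaleNr subrr.
rewrite add0r {S1}.
pose T (i j : 'I_n.+1) := if (i < j)%N then
  (-1) ^+ (i + j) *: f (omit2 i j (beta (x i) (x j)) x) else 0.
have -> : S2 = \sum_i \sum_j T i j.
  by apply: eq_bigr => i _; rewrite big_mkcond.
have Tpq : T p q = 0.
  rewrite /T xpq beta0; case: ifP => // pq.
  have := multilinear_omit2 x 1 0 0 pq fM; rewrite !scale1r addr0 -[LHS]addr0.
  by move/addrI => <-; rewrite scaler0.
have Tij i j : i != p -> i != q -> j != p -> j != q -> T i j = 0.
  move=> nip niq njp njq; rewrite /T; case: ifP => // ij.
  rewrite eq_sym in nip; rewrite eq_sym in njp.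
  rewrite eq_sym in niq; rewrite eq_sym in njq.
  have [p' p0 p'P] := omit2_position ij nip njp.
  have [q' q0 q'P] := omit2_position ij niq njq.
  have pE := eqP (etrans (p'P _ p0) (eqxx _)).
  have q'E := eqP (etrans (q'P _ q0) (eqxx _)).
  rewrite (fA _ p' q') ?scaler0 //.
    by apply: contraNneq npq => pq; rewrite -pE -q'E pq.
  by rewrite !ffunE !gtn_eqF // pE q'E.
have Ti i : i != p -> i != q -> T i p + T i q = 0.
  move=> nip niq.
  have iP : nat_of_ord i <> p by move=> /ord_inj/eqP; rewrite (negPf nip).
  have iQ : nat_of_ord i <> q by move=> /ord_inj/eqP; rewrite (negPf niq).
  rewrite /T; have -> : (i < q)%N = (i < p)%N by lia.
  case: ifP => ip; last by rewrite addr0.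
  rewrite xpq; set w := beta _ _.
  have -> : omit2 i q w x = omit2 i p w x.
    apply/ffunP => l; rewrite !ffunE; case: posnP => // l0.
    have iq : (i < q)%N by lia.
    have lp := omit2_indexE i p l0; have lq := omit2_indexE i q l0.
    have [E|nE] := eqVneq (bump i l.-1) (nat_of_ord p).
      rewrite (_ : inord (bump q _) = p) 1?(_ : inord (bump p _) = q) //;
        by apply: val_inj; rewrite /= ?lp ?lq E /bump; lia.
    congr (x _); apply: val_inj; rewrite /= lp lq /bump.
    by move: nE; rewrite /bump; lia.
  by rewrite qE addnS exprS mulN1r scaleNr subrr.
have Tj j : j != p -> j != q -> T p j + T q j = 0.
  move=> njp njq.
  have jP : nat_of_ord j <> p by move=> /ord_inj/eqP; rewrite (negPf njp).
  have jQ : nat_of_ord j <> q by move=> /ord_inj/eqP; rewrite (negPf njq).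
  rewrite /T; have -> : (q < j)%N = (p < j)%N by lia.
  case: ifP => pj; last by rewrite addr0.
  rewrite xpq; set w := beta _ _.
  have -> : omit2 q j w x = omit2 p j w x.
    apply/ffunP => l; rewrite !ffunE; case: posnP => // l0.
    have lp := omit2_indexE p j l0; have lq := omit2_indexE q j l0.
    have [E|nE] := eqVneq l.-1 (nat_of_ord p).
      rewrite (_ : inord (bump j (bump q _)) = p)
        1?(_ : inord (bump j (bump p _)) = q) //;
        by apply: val_inj; rewrite /= ?lp ?lq E /bump; lia.
    congr (x _); apply: val_inj; rewrite /= lp lq.
    by move: nE; rewrite /bump; lia.
  by rewrite qE addSn exprS mulN1r scaleNr subrr.
apply: (sum_adjacent_eq0 npq) => [i nip niq|].
  by apply: (sum_adjacent_eq0 npq) => [j njp njq|]; [apply: Tij|apply: Ti].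
rewrite -big_split; apply: (sum_adjacent_eq0 npq) => [j njp njq|] /=.
  exact: Tj.
have Tii i : T i i = 0 by rewrite /T ltnn.
have Tqp : T q p = 0 by rewrite /T ifN //; lia.
by rewrite Tpq !Tii Tqp !addr0.
Qed.

End Arguments.

Section Cochains.
Variables (k : fieldType) (g : lmodType k).

Definition cochain_pred n : {pred {ffun 'I_n -> g} -> g} :=
  fun f => `[< multilinear f /\ alternating f >].
Arguments cochain_pred : clear implicits.

Lemma cochain_submod_closed n : submod_closed (cochain_pred n).
Proof.
split=> [|a f h /asboolP[fM fA] /asboolP[hM hA]]; apply/asboolP; split.
- by move=> p x a u v; change (0 = a *: 0 + 0 :> g); rewrite scaler0 addr0.
- by [].
- move=> p x b u v.
  change (a *: f (upd x p (b *: u + v)) + h (upd x p (b *: u + v))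
    = b *: (a *: f (upd x p u) + h (upd x p u))
      + (a *: f (upd x p v) + h (upd x p v))).
  by rewrite fM hM scale_linearP addrACA -scalerDr.
- move=> x p q npq xpq; change (a *: f x + h x = 0).
  by rewrite (fA _ p q) // (hA _ p q) // scaler0 addr0.
Qed.

HB.instance Definition _ n :=
  GRing.isSubmodClosed.Build k _ (cochain_pred n) (cochain_submod_closed n).

(* Hom(/\^n g, g), as the space of alternating n-linear maps. *)
Record cochain (n : nat) := Cochain {
  cochain_fun :> {ffun 'I_n -> g} -> g;
  cochain_funP : cochain_fun \in cochain_pred n
}.

HB.instance Definition _ n := [isSub for @cochain_fun n].
HB.instance Definition _ n := [Choice of cochain n by <:].
HB.instance Definition _ n := [SubChoice_isSubLmodule of cochain n by <:].

End Cochains.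
Arguments cochain {k} g n.
Arguments cochain_pred {k} g n.

Section Differentials.
Variables (k : fieldType) (g : lmodType k).
Implicit Types (L : lie_algebra g) (N : {linear g -> g}).

Lemma ce_formulaP (rho beta : g -> g -> g) n a (f h : {ffun 'I_n -> g} -> g) x :
  (forall y, linear (rho y)) ->
  ce_formula rho beta (a *: f + h) x
  = a *: ce_formula rho beta f x + ce_formula rho beta h x.
Proof.
move=> rhoL; rewrite /ce_formula scalerDr addrACA; congr (_ + _).
  rewrite scaler_sumr -big_split; apply: eq_bigr => i _ /=.
  by rewrite -scale_linearP -rhoL.
rewrite scaler_sumr -big_split; apply: eq_bigr => i _ /=.
rewrite scaler_sumr -big_split; apply: eq_bigr => j ij /=.
by rewrite -scale_linearP.
Qed.

Definition ce_fun L n (f : cochain g n) : {ffun 'I_n.+1 -> g} -> g :=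
  ce_formula L L f.

Lemma ce_fun_subproof L n (f : cochain g n) : ce_fun L f \in cochain_pred g n.+1.
Proof.
have /asboolP[fM fA] := cochain_funP f; apply/asboolP; split.
  exact: ce_multilinear.
by apply: ce_alternating => //; apply: lie_alt.
Qed.

Definition ce_diff L n (f : cochain g n) : cochain g n.+1 :=
  Cochain (ce_fun_subproof L f).

Lemma ce_diff_is_linear L n : linear (@ce_diff L n).
Proof.
move=> a f h; apply: val_inj; apply/funext => x /=.
by apply: ce_formulaP => y b u v; rewrite linearPr.
Qed.

HB.instance Definition _ L n :=
  GRing.isLinear.Build k (cochain g n) (cochain g n.+1) *:%R (@ce_diff L n)
    (@ce_diff_is_linear L n).

Definition deformed_bracket L N (x y : g) : g :=
  [N x, y]_L + [x, N y]_L - N [x, y]_L.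

Definition nijenhuis L N : Prop :=
  forall x y, [N x, N y]_L = N ([N x, y]_L + [x, N y]_L - N [x, y]_L).

Lemma deformed_bracket_is_bilinear L N :
  bilinear_for *:%R *:%R (deformed_bracket L N).
Proof.
have sum3P a (x1 x2 x3 y1 y2 y3 : g) :
    (a *: x1 + y1) + (a *: x2 + y2) - (a *: x3 + y3)
    = a *: (x1 + x2 - x3) + (y1 + y2 - y3).
  by rewrite addrACA -scalerDr opprD -scalerN addrACA -scalerDr.
split=> z a u v; rewrite /deformed_bracket -sum3P.
  by rewrite (linearP N) !linearDl !linearZl_LR (linearP N).
by rewrite (linearP N) !linearPr (linearP N).
Qed.

HB.instance Definition _ L N :=
  bilinear_isBilinear.Build k g g g *:%R *:%R (deformed_bracket L N)
    (deformed_bracket_is_bilinear L N).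

Lemma lie_anticomm L x y : [x, y]_L = - [y, x]_L.
Proof.
apply/eqP; rewrite -addr_eq0; have := lie_alt L (x + y).
by rewrite linearDl !linearDr !lie_alt add0r addr0 => /eqP.
Qed.

Lemma deformed_bracket_alt L N x : deformed_bracket L N x x = 0.
Proof.
by rewrite /deformed_bracket lie_alt linear0 subr0 (lie_anticomm L x) addrN.
Qed.

Lemma deformed_bracket_jacobi L N : nijenhuis L N -> forall x y z,
  let D := deformed_bracket L N in D x (D y z) + D y (D z x) + D z (D x y) = 0.
Proof.
move=> nijN x y z D.
have DD u v w : D u (D v w) =
    ([N u, [N v, w]_L]_L + [N u, [v, N w]_L]_L + [u, [N v, N w]_L]_L)
    + (N (N [u, [v, w]_L]_L)
       - N ([N u, [v, w]_L]_L + [u, [N v, w]_L]_L + [u, [v, N w]_L]_L)).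
  have -> : D u (D v w) = [N u, D v w]_L + [u, N (D v w)]_L - N [u, D v w]_L.
    by [].
  rewrite -nijN /D /deformed_bracket !linearBr !linearDr nijN.
  rewrite !(linearB N, linearD N) /=.
  have E (a b c e2 e3 p q s : g) : a + b - (p + q - s) + c - (e2 + e3 - q)
      = a + b + c + (s - (p + e2 + e3)).
    rewrite !opprD !opprK !addrA.
    by rewrite [LHS](ACl (1*2*6*5*3*7*8*(9*4))) /= subrr addr0.
  exact: E.
have sum9 (a b c a' b' c' a'' b'' c'' : g) : a + b' + c'' = 0 ->
    b + c' + a'' = 0 -> c + a' + b'' = 0 ->
    (a + b + c) + (a' + b' + c') + (a'' + b'' + c'') = 0.
  move=> E1 E2 E3.
  by rewrite (AC (3*3*3) ((1*5*9)*(2*6*7)*(3*4*8))) /= E1 E2 E3 !addr0.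
rewrite !DD [LHS](AC (2*2*2) ((1*3*5)*(2*4*6))) /=.
rewrite [X in X + _]sum9 ?lie_jacobi // add0r [LHS](AC (2*2*2) ((1*3*5)*(2*4*6))) /=.
rewrite -!(linearD N) lie_jacobi !(linear0 N) add0r -!opprD -!(linearD N).
set S := (X in N X); suff -> : S = 0 by rewrite (linear0 N) oppr0.
by rewrite /S [LHS](AC (3*3*3) ((1*6*8)*(2*4*9)*(3*5*7))) /= !lie_jacobi !addr0.

Qed.

Definition deformed_lie L N (nijN : nijenhuis L N) : lie_algebra g :=
  @LieAlgebra k g (deformed_bracket L N) (deformed_bracket_alt L N)
    (deformed_bracket_jacobi nijN).

(* One formula for all degrees; nij_diff0 below gives its value in degree 0. *)
Definition nij_fun L N n (f : cochain g n) (x : {ffun 'I_n.+1 -> g}) : g :=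
  ce_formula (fun u v => [N u, v]_L) (deformed_bracket L N) f x
  - N (ce_fun L f x).

Definition nij_action L N (x y : g) : g := [N x, y]_L.

Lemma nij_action_is_bilinear L N : bilinear_for *:%R *:%R (nij_action L N).
Proof.
split=> z a u v; rewrite /nij_action; last by rewrite linearPr.
by rewrite linearP linearDl linearZl_LR.
Qed.

HB.instance Definition _ L N :=
  bilinear_isBilinear.Build k g g g *:%R *:%R (nij_action L N)
    (nij_action_is_bilinear L N).

Lemma nij_fun_subproof L N n (f : cochain g n) :
  nij_fun L N f \in cochain_pred g n.+1.
Proof.
have /asboolP[fM fA] := cochain_funP f.
have /asboolP[cM cA] := ce_fun_subproof L f.
have nM := ce_multilinear (nij_action L N) (deformed_bracket L N) fM.
have nA := ce_alternating (nij_action L N) (deformed_bracket_alt L N) fM fA.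
apply/asboolP; split=> [p x a u v|x p q npq xpq]; rewrite /nij_fun.
  by rewrite nM cM linearP opprD addrACA -scalerBr.
by rewrite (nA _ p q) // (cA _ p q) // linear0 subr0.
Qed.

Definition nij_diff L N n (f : cochain g n) : cochain g n.+1 :=
  Cochain (nij_fun_subproof L N f).

Lemma nij_diff_is_linear L N n : linear (@nij_diff L N n).
Proof.
move=> a f h; apply: val_inj; apply/funext => x.
rewrite /= /nij_fun /ce_fun.
change (ce_formula (nij_action L N) (deformed_bracket L N) (a *: val f + val h) x
  - N (ce_formula L L (a *: val f + val h) x)
  = a *: nij_fun L N f x + nij_fun L N h x).
rewrite !ce_formulaP; try by move=> y b u v; rewrite linearPr.
by rewrite linearP opprD addrACA -scalerBr.
Qed.

HB.instance Definition _ L N n :=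
  GRing.isLinear.Build k (cochain g n) (cochain g n.+1) *:%R (@nij_diff L N n)
    (@nij_diff_is_linear L N n).

Lemma nij_diff0 L N (f : cochain g 0) (y : {ffun 'I_1 -> g}) :
  let x := f [ffun=> 0] in
  nij_diff L N f y = [N (y ord0), x]_L - N [y ord0, x]_L.
Proof.
move=> x; rewrite /= /nij_fun /ce_fun /ce_formula !big_ord1 !big_mkcond !big_ord1.
rewrite /= !big_mkcond !big_ord1 /= !expr0 !scale1r !addr0.
by have -> : omit ord0 y = [ffun=> 0] by apply/ffunP => -[].
Qed.

Definition Phi L n (f : cochain g n) : cochain g n.+1 :=
  (-1) ^+ n.+1 *: ce_diff L f.

End Differentials.

(* Cohomology of a sequence of maps C 0 -> C 1 -> ..., in each degree the
   quotient of the cocycles by the submodule of those that are coboundaries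
   (in degree 0, only 0 is a coboundary).  For d \o d = 0 this is ker / im. *)
Section Cohomology.
Variables (k : fieldType) (C : nat -> lmodType k).
Variable d : forall n, {linear C n -> C n.+1}.

Definition cocycle_pred n : {pred C n} := fun f => d n f == 0.

Lemma cocycle_submod_closed n : submod_closed (@cocycle_pred n).
Proof.
split=> [|a f h /eqP df /eqP dh]; apply/eqP; first exact: linear0.
by rewrite linearP df dh scaler0 addr0.
Qed.

HB.instance Definition _ n :=
  GRing.isSubmodClosed.Build k (C n) (@cocycle_pred n) (@cocycle_submod_closed n).

Record cocycle (n : nat) := Cocycle {
  cocycle_val :> C n;
  cocycle_valP : cocycle_val \in @cocycle_pred n
}.

HB.instance Definition _ n := [isSub for @cocycle_val n].
HB.instance Definition _ n := [Choice of cocycle n by <:].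
HB.instance Definition _ n := [SubChoice_isSubLmodule of cocycle n by <:].

Definition coboundary n : C n -> Prop :=
  match n with
  | 0 => fun f => f = 0
  | m.+1 => fun f => exists h : C m, d m h = f
  end.

Definition coboundary_pred n : {pred cocycle n} :=
  fun z => `[< coboundary (val z) >].

Lemma coboundary_submod_closed n : submod_closed (@coboundary_pred n).
Proof.
case: n => [|n]; split=> [|a y z /asboolP].
- exact/asboolP.
- move=> /= y0 /asboolP /= z0; apply/asboolP.
  by change (a *: val y + val z = 0); rewrite [val y]y0 [val z]z0 scaler0 addr0.
- by apply/asboolP; exists 0; rewrite linear0.
- move=> -[u uy] /asboolP[v vz]; apply/asboolP; exists (a *: u + v).
  by change (d n (a *: u + v) = a *: val y + val z); rewrite linearP uy vz.
Qed.

HB.instance Definition _ n :=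
  GRing.isSubmodClosed.Build k (cocycle n) (@coboundary_pred n)
    (@coboundary_submod_closed n).

Definition cohomology n := Quotient.quot (@coboundary_pred n).

HB.instance Definition _ n := GRing.Zmodule.on (cohomology n).

Definition coh_class n (z : cocycle n) : cohomology n := \pi_(cohomology n) z.

Lemma coh_class_eq n (y z : cocycle n) :
  coh_class y = coh_class z <-> coboundary (val y - val z).
Proof.
split=> [/eqP|B]; last apply/eqP.
  by rewrite -Quotient.idealrBE => /asboolP; rewrite raddfB.
by rewrite -Quotient.idealrBE; apply/asboolP; rewrite raddfB.
Qed.

Definition coh_scale n (a : k) (c : cohomology n) : cohomology n :=
  coh_class (a *: repr c).

Lemma coh_classK n (c : cohomology n) : coh_class (repr c) = c.
Proof. exact: reprK. Qed.

Lemma coh_scaleE n a (z : cocycle n) :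
  coh_scale a (coh_class z) = coh_class (a *: z).
Proof.
apply/eqP; rewrite -Quotient.idealrBE -scalerBr rpredZ //.
by rewrite Quotient.idealrBE; apply/eqP; apply: (coh_classK (coh_class z)).
Qed.

Lemma coh_classD n (y z : cocycle n) :
  coh_class (y + z) = coh_class y + coh_class z.
Proof. by rewrite /coh_class [LHS]raddfD. Qed.

Lemma coh_scaleA n a b (c : cohomology n) :
  coh_scale a (coh_scale b c) = coh_scale (a * b) c.
Proof. by rewrite -[c]coh_classK !coh_scaleE scalerA. Qed.

Lemma coh_scale1 n : left_id 1 (@coh_scale n).
Proof. by move=> c; rewrite -[c]coh_classK coh_scaleE scale1r. Qed.

Lemma coh_scaleDr n : right_distributive (@coh_scale n) +%R.
Proof.
move=> a b c; rewrite -[b]coh_classK -[c]coh_classK -coh_classD !coh_scaleE.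
by rewrite scalerDr coh_classD.
Qed.

Lemma coh_scaleDl n (c : cohomology n) : {morph (@coh_scale n)^~ c : a b / a + b}.
Proof.
by move=> a b; rewrite -[c]coh_classK !coh_scaleE scalerDl coh_classD.
Qed.

HB.instance Definition _ n := GRing.Zmodule_isLmodule.Build k (cohomology n)
  (@coh_scaleA n) (@coh_scale1 n) (@coh_scaleDr n) (@coh_scaleDl n).

Lemma coh_class_is_linear n : linear (@coh_class n).
Proof. by move=> a y z; rewrite coh_classD -coh_scaleE. Qed.

HB.instance Definition _ n := GRing.isLinear.Build k (cocycle n) (cohomology n)
  *:%R (@coh_class n) (@coh_class_is_linear n).

End Cohomology.

Section CohomologyGroups.
Variables (k : fieldType) (g : lmodType k) (L : lie_algebra g).

Definition ce_complex n : {linear cochain g n -> cochain g n.+1} :=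
  ce_diff L (n:=n).

Definition nij_complex (N : {linear g -> g}) n :
  {linear cochain g n -> cochain g n.+1} := nij_diff L N (n:=n).

Definition H_CE := cohomology ce_complex.

Definition H_Nij (N : {linear g -> g}) := cohomology (nij_complex N).

End CohomologyGroups.

(* Main.v *)
Require Import Defs.
From HB Require Import structures.
From mathcomp Require Import all_boot all_order all_algebra.
From mathcomp Require Import zify.
From mathcomp Require Import boolp functions.

Set Implicit Arguments.
Unset Strict Implicit.
Unset Printing Implicit Defensive.

Import GRing.Theory.
Local Open Scope ring_scope.

(** Write d for the Chevalley-Eilenberg differential of the original bracket, d^N
    for that of the deformed bracket, and D for the operator given by the same
    formula with the action x, y |-> [N x, y] and the deformed bracket; thus
    d_N f = D f - N (d f).  Up to the sign (-1)^(n+1), the identity to prove is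
    d^N (d f) = - d (d_N f).  It rests on three facts.

    - Comparing the formulas term by term, d^N f = D f + d (N f) - N (d f)
      ([ce_deformed]).
    - If i_N inserts N in turn into each argument of a cochain, then
      D = i_N d - d i_N ([insertion_ce]): the deformed bracket is exactly what this
      commutator produces from the bracket.
    - d d = 0 ([ce_ce]).

    The last two make d and D anticommute, and then both sides of the identity are
    - d i_N d f + d (N d f) ([ce_deformed_ce]).

    The last two facts are proved by induction on the degree.  A cochain is
    determined by its contractions f(u, -), and Cartan's formula ([ce_prepend])
    expresses the contraction of d f through the Lie derivative of f along u and
    the differential of the contraction of f.  This is where the signs and the
    omitted positions are dealt with; the rest is algebra of insertions and Lie
    derivatives.

    The map in cohomology exists because Phi intertwines the differentials, so that
    it preserves cocycles and coboundaries ([degree1_cohomology_map]). *)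

Section Cochains.
Variables (k : fieldType) (g : lmodType k).

(** * Arguments of a cochain, the first one apart *)

Definition prepend n (u : g)
    (x : {ffun 'I_n -> g}) : {ffun 'I_n.+1 -> g} :=
  [ffun l => if unlift ord0 l is Some m then x m else u].

Definition contract n (u : g)
    (f : {ffun 'I_n.+1 -> g} -> g) : {ffun 'I_n -> g} -> g :=
  fun x => f (prepend u x).

Lemma prepend0 n (u : g) (x : {ffun 'I_n -> g}) :
  prepend u x ord0 = u.
Proof. by rewrite ffunE unlift_none. Qed.

Lemma prependS n (u : g) (x : {ffun 'I_n -> g}) l :
  prepend u x (lift ord0 l) = x l.
Proof. by rewrite ffunE liftK. Qed.

Lemma prepend_eta n (x : {ffun 'I_n.+1 -> g}) :
  x = prepend (x ord0) (omit ord0 x).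
Proof.
by apply/ffunP => l; rewrite !ffunE; case: unliftP => [m ->|->//]; rewrite ffunE.
Qed.

Lemma upd_prepend0 n (u v : g)
    (x : {ffun 'I_n -> g}) : upd (prepend u x) ord0 v = prepend v x.
Proof.
apply/ffunP => l; rewrite !ffunE; case: unliftP => [m ->|->]; last by rewrite eqxx.
by rewrite eq_sym (negPf (neq_lift _ _)).
Qed.

Lemma upd_prependS n (u v : g)
    (x : {ffun 'I_n -> g}) p :
  upd (prepend u x) (lift ord0 p) v = prepend u (upd x p v).
Proof.
apply/ffunP => l; rewrite !ffunE; case: unliftP => [m ->|->].
  by rewrite ffunE (inj_eq lift_inj).
by rewrite (negPf (neq_lift _ _)).
Qed.

Lemma omit0_prepend n (u : g)
    (x : {ffun 'I_n -> g}) : omit ord0 (prepend u x) = x.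
Proof. by apply/ffunP => l; rewrite ffunE prependS. Qed.

Lemma omitS_prepend n (u : g)
    (x : {ffun 'I_n.+1 -> g}) i :
  omit (lift ord0 i) (prepend u x) = prepend u (omit i x).
Proof.
apply/ffunP => l; rewrite !ffunE; case: (unliftP ord0 l) => [m ->|->].
  have -> : lift (lift ord0 i) (lift ord0 m) = lift ord0 (lift i m).
    by apply: val_inj; rewrite /= /bump /=; lia.
  by rewrite liftK ffunE.
have -> : lift (lift ord0 i) ord0 = ord0 by apply: val_inj; rewrite /= /bump /=; lia.
by rewrite unlift_none.
Qed.

Lemma omit2_0_prepend n (u w : g)
    (x : {ffun 'I_n.+1 -> g}) j :
  omit2 ord0 (lift ord0 j) w (prepend u x) = prepend w (omit j x).
Proof.
apply/ffunP => l; rewrite ffunE [RHS]ffunE.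
case: (unliftP ord0 l) => [[m mn] ->|->//].
rewrite lift0 /= [RHS]ffunE -[RHS](prependS u); congr (prepend u x _).
by apply: val_inj; rewrite /= inordK; rewrite /bump /=; move: mn => /=; lia.
Qed.

(** With both removed positions beyond the first argument [u], the new entry [w]
    goes in front of [u]: compared with prepending [u] to the tuple for [x], the
    first two arguments are exchanged.  This is the source of a sign in Cartan's
    formula. *)
Lemma omit2_S_prepend n (u w : g)
    (x : {ffun 'I_n.+2 -> g}) (i j : 'I_n.+2) : (i < j)%N ->
  omit2 (lift ord0 i) (lift ord0 j) w (prepend u x)
  = prepend w (prepend u (omit ord0 (omit2 i j w x))).
Proof.
move=> ij; apply/ffunP => l; rewrite ffunE [RHS]ffunE.
case: (unliftP ord0 l) => [m ->|->//]; rewrite lift0 /=.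
case: (unliftP ord0 m) => [[p pn] ->|->]; last first.
  rewrite prepend0 -[RHS](prepend0 u x); congr (prepend u x _).
  by apply: val_inj; rewrite /= inordK; rewrite /bump /=; lia.
rewrite prependS [RHS]ffunE [RHS]ffunE lift0 /= -[RHS](prependS u).
congr (prepend u x _); apply: val_inj; move: (pn) => /=.
have pn' : (p < n)%N by move: pn => /=; lia.
rewrite !inordK; rewrite /bump /=; lia.
Qed.

Lemma omit2_prepend n (w : g)
    (x : {ffun 'I_n.+2 -> g}) (i j : 'I_n.+2) :
  omit2 i j w x = prepend w (omit ord0 (omit2 i j w x)).
Proof. by rewrite [LHS]prepend_eta ffunE. Qed.

(** The usual polarization of f(.., a + b, .., a + b, ..) = 0; alternation is
    stated by repeated arguments, since the characteristic may be 2. *)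
Lemma alternating_swap n (f : {ffun 'I_n -> g} -> g) x (p q : 'I_n) a b :
  multilinear f -> alternating f -> p != q ->
  f (upd (upd x p a) q b) = - f (upd (upd x p b) q a).
Proof.
move=> fM fA npq; pose F u v := f (upd (upd x p u) q v).
have updC u v : upd (upd x p u) q v = upd (upd x q v) p u.
  apply/ffunP => l; rewrite !ffunE.
  by have [->|//] := eqVneq l q; rewrite eq_sym (negPf npq).
have FDr u v w : F u (v + w) = F u v + F u w.
  by rewrite /F -[v in LHS]scale1r fM scale1r.
have FDl u v w : F (u + v) w = F u w + F v w.
  by rewrite /F !updC -[u in LHS]scale1r fM scale1r.
have F0 u : F u u = 0.
  by apply: (fA _ p q) => //; rewrite !ffunE !eqxx (negPf npq).
have := F0 (a + b); rewrite FDr !FDl !F0 add0r addr0 addrC => /eqP.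
by rewrite addr_eq0 => /eqP.
Qed.

Lemma prepend_swap n
    (f : {ffun 'I_n.+2 -> g} -> g) u v (x : {ffun 'I_n -> g}) :
  multilinear f -> alternating f ->
  f (prepend u (prepend v x)) = - f (prepend v (prepend u x)).
Proof.
move=> fM fA; pose z := prepend u (prepend v x).
have E a b : prepend a (prepend b x) = upd (upd z ord0 a) (lift ord0 ord0) b.
  by rewrite upd_prepend0 upd_prependS upd_prepend0.
by rewrite !E (alternating_swap _ _ _ fM fA).
Qed.

Lemma contract_multilinear n u
    (f : {ffun 'I_n.+1 -> g} -> g) : multilinear f -> multilinear (contract u f).
Proof. by move=> fM p x a v w; rewrite /contract -!upd_prependS fM. Qed.

Lemma contract_alternating n u
    (f : {ffun 'I_n.+1 -> g} -> g) : alternating f -> alternating (contract u f).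
Proof.
move=> fA x p q npq xpq; apply: (fA _ (lift ord0 p) (lift ord0 q)).
  by rewrite (inj_eq lift_inj).
by rewrite !prependS.
Qed.

(** Moving the first argument to position [j] passes over [j] others. *)
Lemma prepend_omit n
    (f : {ffun 'I_n.+1 -> g} -> g) u (x : {ffun 'I_n.+1 -> g}) (j : 'I_n.+1) :
  multilinear f -> alternating f ->
  f (prepend u (omit j x)) = (-1) ^+ j *: f (upd x j u).
Proof.
elim: n => [|n IHn] in f x j * => fM fA; rewrite {1 2}[x]prepend_eta.
  by rewrite ord1 omit0_prepend upd_prepend0 expr0 scale1r.
case: (unliftP ord0 j) => [i ->|->].
  rewrite omitS_prepend prepend_swap // upd_prependS lift0 exprS mulN1r scaleNr.
  congr (- _); apply: (IHn (contract (x ord0) f)).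
    exact: contract_multilinear.
  exact: contract_alternating.
by rewrite omit0_prepend upd_prepend0 expr0 scale1r.
Qed.

(** * Insertion of an endomorphism *)

(** The insertion operator i_A: the derivation of degree 0 that extends A to
    cochains. *)
Definition insertion n (A : g -> g)
    (f : {ffun 'I_n -> g} -> g) : {ffun 'I_n -> g} -> g :=
  fun x => \sum_p f (upd x p (A (x p))).

Lemma insertion_prepend n (A : g -> g)
    (f : {ffun 'I_n.+1 -> g} -> g) v x :
  insertion A f (prepend v x) = f (prepend (A v) x) + insertion A (contract v f) x.
Proof.
rewrite /insertion big_ord_recl prepend0 upd_prepend0; congr (_ + _).
by apply: eq_bigr => p _; rewrite prependS upd_prependS.
Qed.

Lemma insertion0 (A : g -> g)
    (f : {ffun 'I_0 -> g} -> g) x : insertion A f x = 0.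
Proof. by rewrite /insertion big_ord0. Qed.

Lemma insertionD n (A : g -> g)
    (f h : {ffun 'I_n -> g} -> g) x :
  insertion A (f + h) x = insertion A f x + insertion A h x.
Proof. by rewrite /insertion -big_split. Qed.

(** A |-> i_A reverses commutators.  Both sides applied to [prepend v y] split
    into terms where A and B both hit [v], where exactly one of them does, and
    where neither does; the last ones are the case of [contract v f].  The identity
    is written without subtraction so that it is a mere reordering of terms. *)
Lemma insertion_comm (A B : g -> g) n
    (f : {ffun 'I_n -> g} -> g) x :
  insertion A (insertion B f) x + insertion (A \o B) f x
  = insertion B (insertion A f) x + insertion (B \o A) f x.
Proof.
elim: n => [|n IHn] in f x *; first by rewrite !insertion0 !addr0.
have split_comm (C D : g -> g) v (y : {ffun 'I_n -> g}) :
    insertion C (insertion D f) (prepend v y)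
    = f (prepend (D (C v)) y) + insertion D (contract (C v) f) y
      + insertion C (contract (D v) f) y
      + insertion C (insertion D (contract v f)) y.
  rewrite insertion_prepend -[RHS]addrA insertion_prepend; congr (_ + _).
  rewrite -insertionD; congr (insertion C _ y); apply/funext => z.
  exact: insertion_prepend.
rewrite [x]prepend_eta !split_comm !insertion_prepend /=.
rewrite [LHS](AC (4*2) ((1*5)*(2*3)*(4*6))) /= IHn.
by rewrite [RHS](AC (4*2) ((5*1)*(3*2)*(4*6))).
Qed.

Lemma insertion_multilinear n (A : g -> g)
    (f : {ffun 'I_n -> g} -> g) :
  linear A -> multilinear f -> multilinear (insertion A f).
Proof.
move=> AL fM p x a u v; rewrite /insertion scaler_sumr -big_split.
apply: eq_bigr => q _ /=; rewrite !ffunE.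
have [->|nqp] := eqVneq q p.
  have updK b c : upd (upd x p b) p c = upd x p c.
    by apply/ffunP => l; rewrite !ffunE; case: eqP.
  by rewrite !updK AL fM.
have updC b : upd (upd x p b) q (A (x q)) = upd (upd x q (A (x q))) p b.
  apply/ffunP => l; rewrite !ffunE.
  by have [->|//] := eqVneq l q; rewrite (negPf nqp).
by rewrite !updC fM.
Qed.

Lemma insertion_alternating n (A : g -> g)
    (f : {ffun 'I_n -> g} -> g) :
  multilinear f -> alternating f -> alternating (insertion A f).
Proof.
move=> fM fA x p q npq xpq; rewrite /insertion.
apply: (sum_adjacent_eq0 npq) => [i nip niq|].
  by apply: (fA _ p q) => //; rewrite !ffunE ![_ == i]eq_sym (negPf nip) (negPf niq).
have -> : upd x p (A (x p)) = upd (upd x p (A (x p))) q (x p).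
  apply/ffunP => l; rewrite !ffunE.
  by have [->|//] := eqVneq l q; rewrite eq_sym (negPf npq).
have -> : upd x q (A (x q)) = upd (upd x p (x p)) q (A (x p)).
  apply/ffunP => l; rewrite !ffunE xpq.
  by have [//|_] := eqVneq l q; case: eqP => // ->.
by rewrite (alternating_swap _ _ _ fM fA npq) addNr.
Qed.

(** * Cartan's formula *)

Lemma ce_prepend0 (rho beta : g -> g -> g)
    (f : {ffun 'I_0 -> g} -> g) u x :
  ce_formula rho beta f (prepend u x) = rho u (f x).
Proof.
rewrite /ce_formula !big_ord1 big_mkcond big_ord1 /= expr0 scale1r addr0.
by rewrite prepend0 omit0_prepend.
Qed.

(** Cartan's formula: contracting by [u] turns the Chevalley-Eilenberg operator
    into the Lie derivative rho(u) - i_{beta(u,-)}, minus the operator applied to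
    the contraction.  The terms of the formula that involve position 0 give the Lie
    derivative.  This is a formal identity in [rho] and [beta], so that it also
    serves for the operator with a deformed bracket in [insertion_ce]; together with
    [prepend_eta] it allows induction on the degree in place of sums over pairs of
    positions. *)
Lemma ce_prepend (rho beta : g -> g -> g) n
    (f : {ffun 'I_n.+1 -> g} -> g) u x :
  multilinear f -> alternating f ->
  ce_formula rho beta f (prepend u x)
  = rho u (f x) - insertion (beta u) f x - ce_formula rho beta (contract u f) x.
Proof.
move=> fM fA; rewrite /ce_formula opprD.
rewrite [X in X + _ = _]big_ord_recl prepend0 omit0_prepend expr0 scale1r.
rewrite [X in _ + X = _]big_ord_recl.
rewrite -[LHS]addrA -[RHS]addrA; congr (_ + _).
rewrite [LHS](AC (1*2) (2*1*3)) [RHS](AC (1*2) (1*2*3)) /=; congr (_ + _ + _).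
- rewrite /insertion -sumrN big_mkcond big_ord_recl /= add0r.
  apply: eq_bigr => j _; rewrite prepend0 prependS omit2_0_prepend.
  rewrite prepend_omit // scalerA -exprD /bump leq0n add0n -addnA addnn.
  by rewrite add1n exprS mulN1r -mul2n exprM sqrrN !expr1n scaleN1r.
- rewrite -sumrN; apply: eq_bigr => i _; rewrite prependS omitS_prepend.
  by rewrite /= /bump leq0n add1n exprS mulN1r scaleNr.
rewrite -sumrN; apply: eq_bigr => i _; rewrite big_mkcond big_ord_recl /= add0r.
rewrite -sumrN [RHS]big_mkcond; apply: eq_bigr => j _ /=.
rewrite /bump !leq0n !add1n ltnS; case: ifP => // ij.
rewrite !prependS addSn addnS !exprS mulrA mulrNN mul1r mul1r -scalerN; congr (_ *: _).
(* In degree 1 there is no pair of positions i < j. *)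
case: n => [|n] in f x i j fM fA ij *; first by rewrite ord1 in ij; rewrite [j]ord1 in ij.
by rewrite omit2_S_prepend // prepend_swap // -omit2_prepend.
Qed.

(** * The commutator of an insertion with the differential *)

Lemma insertion_funD n (A B C : g -> g)
    (f : {ffun 'I_n -> g} -> g) x : multilinear f ->
  insertion (fun u => A u + B u - C u) f x
  = insertion A f x + insertion B f x - insertion C f x.
Proof.
move=> fM; rewrite /insertion -sumrN -!big_split; apply: eq_bigr => p _ /=.
have -> : A (x p) + B (x p) - C (x p) = -1 *: C (x p) + (1 *: A (x p) + B (x p)).
  by rewrite scaleN1r scale1r addrC.
by rewrite !fM scaleN1r scale1r addrC.
Qed.

Lemma ce_formulaB (rho beta : g -> g -> g) n
    (f h : {ffun 'I_n -> g} -> g) x :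
  (forall y, linear (rho y)) ->
  ce_formula rho beta (fun y => f y - h y) x
  = ce_formula rho beta f x - ce_formula rho beta h x.
Proof.
move=> rhoL; rewrite addrC -scaleN1r -ce_formulaP //; congr ce_formula.
by apply/funext => y; rewrite addrC -scaleN1r.
Qed.

Lemma ce_formulaD (rho beta : g -> g -> g) n
    (f h : {ffun 'I_n -> g} -> g) x :
  (forall y, linear (rho y)) ->
  ce_formula rho beta (fun y => f y + h y) x
  = ce_formula rho beta f x + ce_formula rho beta h x.
Proof.
move=> rhoL; rewrite -[X in _ = X + _]scale1r -ce_formulaP //; congr ce_formula.
by apply/funext => y; rewrite -[f y in LHS]scale1r.
Qed.

(** The commutator of i_A with the operator of ([rho], [beta]) is the operator of
    (rho(A -), beta_A), where beta_A is [beta] deformed by A.  Contraction by [v]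
    reduces this to the contracted cochain, by Cartan's formula for both operators;
    what remains is the commutator of i_A with the insertion of beta(v, -), given by
    [insertion_comm]. *)
Lemma insertion_ce (rho beta : {bilinear g -> g -> g}) (A : {linear g -> g}) n
    (f : {ffun 'I_n -> g} -> g) x :
  multilinear f -> alternating f ->
  insertion A (ce_formula rho beta f) x
  = ce_formula rho beta (insertion A f) x
    + ce_formula (fun u v => rho (A u) v)
        (fun u v => beta (A u) v + beta u (A v) - A (beta u v)) f x.
Proof.
have rhoL u : linear (rho u) by move=> a v w; rewrite linearPr.
have rhoAL u : linear (rho (A u)) by [].
elim: n => [|n IHn] in f x * => fM fA;
  rewrite [x]prepend_eta; set v := x ord0; set y := omit ord0 x.
  rewrite insertion_prepend insertion0 addr0 !ce_prepend0 insertion0 linear0r.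
  by rewrite add0r.
have cM := contract_multilinear v fM; have cA := contract_alternating v fA.
have AfM := insertion_multilinear (linearP A) fM.
have AfA := insertion_alternating A fM fA.
rewrite insertion_prepend !ce_prepend // insertion_funD //.
have -> : insertion A (contract v (ce_formula rho beta f)) y
  = rho v (insertion A f y) - insertion A (insertion (beta v) f) y
    - insertion A (ce_formula rho beta (contract v f)) y.
  rewrite /insertion linear_sumr -!sumrB; apply: eq_bigr => p _.
  by rewrite /contract ce_prepend.
have -> : contract v (insertion A f)
  = fun z => contract (A v) f z + insertion A (contract v f) z.
  by apply/funext => z; rewrite /contract insertion_prepend.
rewrite ce_formulaD // IHn //.
have -> : insertion A (insertion (beta v) f) y
  = insertion (beta v) (insertion A f) y + insertion (beta v \o A) f y
    - insertion (A \o beta v) f y.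
  by rewrite -insertion_comm addrK.
(* Opaque names keep the rewriting below from unfolding ce_formula to a sum. *)
set dAv := ce_formula rho beta (contract (A v) f) y.
set dA := ce_formula rho beta (insertion A _) y.
set dR := ce_formula _ _ (contract v f) y.
clearbody dAv dA dR; rewrite !opprD !opprK !addrA.
by rewrite [LHS](ACl (4*5*3*8*1*2*6*7*9)).
Qed.

(** * The square of the Chevalley-Eilenberg differential *)

Definition lie_derivative (L : lie_algebra g)
    (u : g) n (f : {ffun 'I_n -> g} -> g) : {ffun 'I_n -> g} -> g :=
  fun x => L u (f x) - insertion (L u) f x.

Lemma lie_leibniz (L : lie_algebra g) (u v w : g) :
  [u, [v, w]_L]_L = [[u, v]_L, w]_L + [v, [u, w]_L]_L.
Proof.
have J := lie_jacobi L u v w.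
rewrite (lie_anticomm L [u, v]_L w) (lie_anticomm L u w) linearNr -opprD.
by apply/eqP; rewrite -addr_eq0 [X in _ + X]addrC addrA J.
Qed.

(** The Lie derivative along [u] is ad u acting on values minus the insertion of
    ad u.  By [insertion_ce], the commutator of the latter with the differential is
    the operator of (ad [u, -], beta_A) with A = ad u.  Here beta_A vanishes, as
    ad u is a derivation, and what is left equals the commutator of the
    differential with ad u acting on values. *)
Lemma ce_lie_derivative (L : lie_algebra g) u n
    (f : {ffun 'I_n -> g} -> g) x :
  multilinear f -> alternating f ->
  ce_formula L L (lie_derivative L u f) x = lie_derivative L u (ce_formula L L f) x.
Proof.
move=> fM fA; have LL w : linear (L w) by move=> a y z; rewrite linearPr.
rewrite /lie_derivative ce_formulaB // (insertion_ce L L (L u)) //.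
set dR := ce_formula (fun w v => L (L u w) v) _ f x.
suff -> : L u (ce_formula L L f x) = ce_formula L L (fun y => L u (f y)) x + dR.
  (* On variables: ce_formula unfolds to a sum, which rewriting would regroup. *)
  have E (a b c : g) : a - b = (a + c) - (b + c).
    by rewrite opprD addrACA subrr addr0.
  exact: E.
rewrite /dR /ce_formula linearDr !linear_sumr addrACA.
congr (_ + _); rewrite -big_split; apply: eq_bigr => i _ /=.
  by rewrite linearZr_LR lie_leibniz scalerDr addrC.
rewrite linear_sumr -big_split; apply: eq_bigr => j ij /=.
rewrite linearZr_LR (lie_leibniz L u) subrr.
suff -> : f (omit2 i j 0 x) = 0 by rewrite scaler0 addr0.
have := multilinear_omit2 x 1 0 0 ij fM; rewrite !scale1r addr0 -[LHS]addr0.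
by move=> /addrI <-.
Qed.

(** By Cartan's formula, the contraction of d (d f) by [u] is the commutator of d
    with the Lie derivative along [u], which vanishes, plus d (d (contract u f)). *)
Lemma ce_ce (L : lie_algebra g) n
    (f : {ffun 'I_n -> g} -> g) x :
  multilinear f -> alternating f -> ce_formula L L (ce_formula L L f) x = 0.
Proof.
have LL w : linear (L w) by move=> a y z; rewrite linearPr.
elim: n => [|n IHn] in f x * => fM fA;
  rewrite [x]prepend_eta; set u := x ord0; set y := omit ord0 x;
  have dM := ce_multilinear L L fM; have dA := ce_alternating L (lie_alt L) fM fA.
  rewrite ce_prepend // -/(lie_derivative L u _ y) -ce_lie_derivative //.
  apply/eqP; rewrite subr_eq0; apply/eqP; congr ce_formula; apply/funext => z.
  by rewrite /contract ce_prepend0 /lie_derivative insertion0 subr0.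
rewrite ce_prepend // -/(lie_derivative L u _ y) -ce_lie_derivative //.
have -> : contract u (ce_formula L L f)
  = fun z => lie_derivative L u f z - ce_formula L L (contract u f) z.
  by apply/funext => z; rewrite /contract ce_prepend.
rewrite ce_formulaB // IHn ?subr0 ?subrr //.
  exact: contract_multilinear.
exact: contract_alternating.
Qed.

(** * The deformed differential *)

(** The adjoint action of the deformed bracket exceeds the action y |-> [N x, y] by
    y |-> [x, N y] - N [x, y].  These two terms give the first sums in the
    differential of N f and in N applied to that of f; the second sums of those two
    are equal and cancel. *)
Lemma ce_deformed (L : lie_algebra g)
    (N : {linear g -> g}) n (f : {ffun 'I_n -> g} -> g) x :
  ce_formula (deformed_bracket L N) (deformed_bracket L N) f x
  = ce_formula (nij_action L N) (deformed_bracket L N) f x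
    + (ce_formula L L (N \o f) x - N (ce_formula L L f x)).
Proof.
rewrite /ce_formula linearD !linear_sum opprD [X in _ = _ + X]addrACA.
rewrite [RHS]addrACA; congr (_ + _).
  rewrite -sumrN -!big_split; apply: eq_bigr => i _ /=.
  by rewrite /deformed_bracket !linearZ_LR /= !scalerDr scalerN addrA.
rewrite -sumrN -[X in _ = _ + X]big_split [X in _ = _ + X]big1 ?addr0 // => i _ /=.
rewrite linear_sum -sumrN -big_split big1 // => j _ /=.
by rewrite linearZ_LR subrr.
Qed.

(** With d the differential of the original bracket and D that of the action
    [N x, y] and the deformed bracket, D = i_N d - d i_N, so that d d = 0 gives
    D d = - d i_N d = - d D.  The deformed differential of d f is D d f + d (N d f),
    while d_N f = D f - N d f. *)
Lemma ce_deformed_ce (L : lie_algebra g)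
    (N : {linear g -> g}) n (f : cochain g n) x :
  let D := deformed_bracket L N in
  ce_formula D D (ce_fun L f) x = - ce_formula L L (nij_fun L N f) x.
Proof.
move=> D; have /asboolP[fM fA] := cochain_funP f.
have /asboolP[dM dA] := cochain_funP (ce_diff L f).
have LL w : linear (L w) by move=> a y z; rewrite linearPr.
have insN h y : multilinear h -> alternating h ->
  ce_formula (nij_action L N) D h y
  = insertion N (ce_formula L L h) y - ce_formula L L (insertion N h) y.
  by move=> hM hA; rewrite insertion_ce // addrC addKr.
rewrite ce_deformed insN //.
have -> : ce_formula L L (ce_fun L f) = fun=> 0.
  by apply/funext => y; apply: ce_ce.
have -> : nij_fun L N f = fun y => insertion N (ce_fun L f) y
    - ce_formula L L (insertion N f) y - N (ce_fun L f y).
  by apply/funext => y; rewrite /nij_fun [X in X - _]insN.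
have ddN : ce_formula L L (ce_formula L L (insertion N f)) x = 0.
  apply: ce_ce; first exact: insertion_multilinear (linearP N) fM.
  exact: insertion_alternating.
rewrite !ce_formulaB // ddN.
by rewrite /insertion big1 // linear0 sub0r !subr0 opprB addrC.
Qed.

End Cochains.

(** * The induced map in cohomology *)

(** In degree 0 only 0 is a coboundary, and its image is the differential of 0;
    this is why degree 0 is treated apart in the proof. *)
Lemma degree1_cohomology_map (k : fieldType) (C C' : nat -> lmodType k)
    (d : forall n, {linear C n -> C n.+1}) (d' : forall n, {linear C' n -> C' n.+1})
    (phi : forall n, {linear C n -> C' n.+1}) :
  (forall n f, d' n.+1 (phi n f) = phi n.+1 (d n f)) ->
  exists h : forall n, {linear cohomology d n -> cohomology d' n.+1},
    forall n (z : cocycle d n), exists w : cocycle d' n.+1,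
      cocycle_val w = phi n (cocycle_val z) /\ h n (coh_class z) = coh_class w.
Proof.
move=> phiE.
have phi_cocycle n (z : cocycle d n) : phi n (val z) \in @cocycle_pred k C' d' n.+1.
  by apply/eqP; rewrite phiE (eqP (cocycle_valP z)) linear0.
pose phiz n (z : cocycle d n) := Cocycle (phi_cocycle n z).
pose hf n (c : cohomology d n) : cohomology d' n.+1 := coh_class (phiz n (repr c)).
have hfE n (z : cocycle d n) : hf n (coh_class z) = coh_class (phiz n z).
  apply/coh_class_eq; rewrite /= -linearB.
  have /coh_class_eq := coh_classK (coh_class z).
  move: (repr _) => y; case: n => [|n] in y z *.
    by move=> /= ->; exists 0; rewrite !linear0.
  by move=> [b /= <-]; exists (phi n b); rewrite phiE.
have hf_linear n : linear (hf n).
  move=> a b c; rewrite -[b]coh_classK -[c]coh_classK -linearP !hfE -linearP.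
  by congr coh_class; apply: val_inj; rewrite /= linearP.
exists (fun n => HB.pack_for {linear cohomology d n -> cohomology d' n.+1} (hf n)
  (GRing.isLinear.Build _ _ _ _ (hf n) (hf_linear n))).
by move=> n z; exists (phiz n z); split; last exact: hfE.
Qed.

Lemma Phi_is_linear (k : fieldType) (g : lmodType k) (L : lie_algebra g) n :
  linear (@Phi k g L n).
Proof. by move=> a f h; rewrite /Phi linearP scale_linearP. Qed.

HB.instance Definition _ (k : fieldType) (g : lmodType k) (L : lie_algebra g) n :=
  GRing.isLinear.Build k (cochain g n) (cochain g n.+1) *:%R (@Phi k g L n)
    (@Phi_is_linear k g L n).

Theorem proposition3p2 (k : fieldType) (g : lmodType k) (L : lie_algebra g)
    (N : {linear g -> g}) (nijN : nijenhuis L N) :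
  (forall (n : nat) (f : cochain g n),
     ce_diff (deformed_lie nijN) (Phi L f) = Phi L (nij_diff L N f))
  /\
  (exists h : forall n : nat,
       {linear H_Nij L N n -> H_CE (deformed_lie nijN) n.+1},
     forall (n : nat) (z : cocycle (nij_complex L N) n),
       exists w : cocycle (ce_complex (deformed_lie nijN)) n.+1,
         cocycle_val w = Phi L (cocycle_val z)
         /\ h n (coh_class z) = coh_class w).
Proof.
have comm n (f : cochain g n) :
    ce_diff (deformed_lie nijN) (Phi L f) = Phi L (nij_diff L N f).
  rewrite /Phi linearZ_LR [in RHS]exprS mulN1r scaleNr -scalerN; congr (_ *: _).
  by apply: val_inj; apply/funext => x; exact: ce_deformed_ce.
split=> //.
exact: (@degree1_cohomology_map _ _ _ (nij_complex L N)
  (ce_complex (deformed_lie nijN)) (fun n => @Phi k g L n) comm).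
Qed.
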